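(* Let $\mathbb{X}$ be an $n$-dimensional Banach space over $\mathbb{R}$ or $\mathbb{C}$ with unit sphere $S_{\mathbb{X}}$, and let $W=\{v_1,\dots,v_n\}$ be a basis of $\mathbb{X}$ with $v_i\in S_{\mathbb{X}}$ for $i=1,2,\dots,n$. Then $W$ is an Auerbach basis of $\mathbb{X}$ if and only if $v_i$ is a bifurcation point of $|\det|_W^i$ for all $i$.
   Context: A basis $\{v_1,\dots,v_n\}$ of $\mathbb{X}$ is an Auerbach basis if $v_i\in S_{\mathbb{X}}$ for all $i$ and there is a basis $\{v^1,\dots,v^n\}$ of the dual space $\mathbb{X}^*$ with $v^i(v_j)=\delta_{ij}$ and $v^i\in S_{\mathbb{X}^*}$ for all $i,j$. Identify $\mathbb{X}$ linearly with $\mathbb{R}^n$ (resp. $\mathbb{C}^n$), so that $\det$ of an $n$-tuple of vectors of $\mathbb{X}$ is defined. For $1\le i\le n$ the function $|\det|^i_W\colon S_{\mathbb{X}}\to\mathbb{R}$ is \[ |\det|^i_W(x)=|\det(v_1,\dots,v_{i-1},x,v_{i+1},\dots,v_n)|. \] For a topological manifold $M$ and a continuous function $g\colon M\to\mathbb{R}$, a point $x\in M$ is a (topologically) regular point of $g$ if there exist a neighborhood $U$ of $x$, a topological space $S$, an interval $(a-\epsilon,a+\epsilon)$ and a homeomorphism $h\colon S\times(a-\epsilon,a+\epsilon)\to U$ such that $g\circ h$ is the projection onto the second factor. A point that is not topologically regular is a bifurcation point. *)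

(* Defs.v *)
From HB Require Import structures.
From mathcomp Require Import all_boot all_order all_algebra.
From mathcomp Require Import all_classical all_reals all_analysis.
From mathcomp Require Export complex.

Set Implicit Arguments.
Unset Strict Implicit.
Unset Printing Implicit Defensive.

Import Order.TTheory GRing.Theory Num.Theory.
Import numFieldNormedType.Exports.

Local Open Scope classical_set_scope.
Local Open Scope ring_scope.

#[short(type="finBanachType")]
HB.structure Definition FinBanach (K : numFieldType) :=
  {X of Vector K X & CompleteNormedModule K X}.

Definition homeomorphism (S T : topologicalType) (h : S -> T) : Prop :=
  continuous h /\
  exists h' : T -> S, [/\ continuous h', cancel h h' & cancel h' h].

(* A set [A] used as a type carries the subspace topology. *)
Definition regular_point (R : realType) (M : topologicalType) (g : M -> R)
    (x : M) : Prop :=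
  exists (U : set M) (S : topologicalType) (a eps : R)
         (h : S * set_type `]a - eps, a + eps[%classic -> set_type U),
    [/\ nbhs x U, 0 < eps, homeomorphism h
      & forall p, g (set_val (h p)) = set_val p.2].

Definition bifurcation_point (R : realType) (M : topologicalType)
    (g : M -> R) (x : M) : Prop :=
  ~ regular_point g x.

(* The norm of a [normedModType K] takes its values in [K] itself. For
   [K] equal to [R] or [R[i]], [absK : K -> R] is the modulus with values
   in [R]. *)
Section Auerbach.
Variables (R : realType) (K : numFieldType) (absK : K -> R).
Variable X : finBanachType K.

Definition unit_sphere : set X := [set x | `|x| = 1].

(* As [X] is finite-dimensional, every linear form on it is continuous, so
   ['Hom(X, K^o)] is the whole dual space. *)
Definition dual_norm (f : 'Hom(X, K^o)) : R :=
  sup [set absK (f x) | x in [set x : X | `|x| <= 1]].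

Definition auerbach_basis (n : nat) (W : n.-tuple X) : Prop :=
  [/\ basis_of fullv W, forall i, unit_sphere (tnth W i)
    & exists W' : n.-tuple 'Hom(X, K^o),
        [/\ basis_of fullv W',
            forall i j, tnth W' i (tnth W j) = (i == j)%:R
          & forall i, dual_norm (tnth W' i) = 1]].

(* [phi] is the linear identification of [X] with [K^n] through which
   determinants of [n]-tuples of vectors of [X] are taken. *)
Definition absdet (n : nat) (phi : X -> 'rV[K]_n) (W : n.-tuple X) (i : 'I_n)
    (x : set_type unit_sphere) : R :=
  absK (\det (\matrix_(j < n) phi (if j == i then set_val x else tnth W j))).

End Auerbach.

Arguments unit_sphere {K} X.

(* Main.v *)
From HB Require Import structures.
Require Import Defs.
From mathcomp Require Import all_boot all_order all_algebra.
From mathcomp Require Import all_classical all_reals all_analysis.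
From mathcomp Require Import lra.
Import Order.TTheory GRing.Theory Num.Theory.
Import numFieldNormedType.Exports.
Local Open Scope classical_set_scope.
Local Open Scope ring_scope.

(** By linearity |det|_W^i = |det W| |f| with [f] the i-th coordinate functional
    of the basis [W], and [f v_i = 1]; so [W] is Auerbach iff |f| <= 1 on the
    unit ball for every i. A regular point is never a local maximum, which gives
    one direction. Conversely, if |f| exceeds 1 somewhere on the ball, pick [y]
    with [f y = 1] and |y| < 1, and write [x = f x y + p x] with [f (p x) = 0].
    As long as [c |y| < 1], the ray from [c (f x / |f x|) y] in direction [p x]
    leaves the ball, by convexity, at exactly one point, which depends
    continuously on [x] and [c]. Moving [x] to that point changes |f x| into
    [c], and this motion along the level sets trivializes |f| near [v_i]. *)

(** * Maps into subspaces *)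

Definition in_set_type {T : Type} {A : set T} {x : T} (Ax : x \in A) : set_type A :=
  exist (fun x => x \in A) x Ax.

Lemma continuous_in_set_type {T Y : topologicalType} (A : set Y) (h : T -> Y)
    (hA : forall t, h t \in A) :
  continuous h -> continuous (fun t => in_set_type (hA t) : set_type A).
Proof. by move=> ch; apply: continuous_comp_initial. Qed.

(** * Real-valued modulus and norm over the scalar field *)

(* [K] stands for [R] or [R[i]]; [e] is the embedding of [R] into [K]. *)
Section RealValuedNorm.
Context {R : realType} {K : numFieldType}.
Variables (e : {rmorphism R -> K}) (absK : K -> R).
Hypothesis e_le : {mono e : a b / a <= b}.
Hypothesis e_abs : forall z, e (absK z) = `|z|.

Let e_lt : {mono e : a b / a < b}.
Proof. exact: leW_mono. Qed.

Let e_inj : injective e.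
Proof. exact: fmorph_inj. Qed.

Lemma scal_norm (r : R) : `|e r| = e `|r|.
Proof.
case: (lerP 0 r) => r0; first by rewrite !ger0_norm // -(rmorph0 e) e_le.
by rewrite !ltr0_norm ?rmorphN // -(rmorph0 e) e_lt.
Qed.

Lemma absK_ge0 z : 0 <= absK z.
Proof. by rewrite -e_le rmorph0 e_abs. Qed.

Lemma absKM : {morph absK : a b / a * b}.
Proof. by move=> a b; apply: e_inj; rewrite rmorphM !e_abs normrM. Qed.

Lemma absK_scal r : absK (e r) = `|r|.
Proof. by apply: e_inj; rewrite e_abs scal_norm. Qed.

Lemma absK_eq0 z : (absK z == 0) = (z == 0).
Proof. by rewrite -(inj_eq e_inj) e_abs rmorph0 normr_eq0. Qed.

Lemma absK_norm z : absK `|z| = absK z.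
Proof. by apply: e_inj; rewrite !e_abs normr_id. Qed.

Lemma absKV z : absK z^-1 = (absK z)^-1.
Proof. by apply: e_inj; rewrite fmorphV !e_abs normfV. Qed.

Lemma scal_continuous : continuous e.
Proof.
move=> a; apply/cvgrPdist_lt => eps eps0.
(* A positive element of [K] equals its own modulus, so it is the image under [e] of a real
   number. *)
have epsE : e (absK eps) = eps by rewrite e_abs gtr0_norm.
have h0 : 0 < absK eps by rewrite -e_lt rmorph0 epsE.
near=> b; rewrite -rmorphB scal_norm -epsE e_lt.
by near: b; apply: cvgr_dist_lt => //; exact: cvg_id.
Unshelve. all: by end_near. Qed.

Lemma absK_continuous : continuous absK.
Proof.
move=> a; apply/(@cvgrPdist_lt _ _ _ (nbhs a)) => eps eps0.
have h0 : 0 < e eps by rewrite -(rmorph0 e) e_lt.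
near=> b; rewrite -e_lt -scal_norm rmorphB !e_abs.
apply: le_lt_trans (ler_dist_dist _ _) _.
by near: b; apply: cvgr_dist_lt => //; exact: cvg_id.
Unshelve. all: by end_near. Qed.

Context {X : normedModType K}.

Definition normR (x : X) : R := absK `|x|.

Lemma scal_normR x : e (normR x) = `|x|.
Proof. by rewrite e_abs normr_id. Qed.

Lemma normR_ge0 x : 0 <= normR x.
Proof. exact: absK_ge0. Qed.

Lemma normRZ z x : normR (z *: x) = absK z * normR x.
Proof. by rewrite /normR normrZ absKM absK_norm. Qed.

Lemma ler_normRD x y : normR (x + y) <= normR x + normR y.
Proof. by rewrite -e_le rmorphD !scal_normR ler_normD. Qed.

Lemma normR_eq0 x : (normR x == 0) = (x == 0).
Proof. by rewrite absK_eq0 normr_eq0. Qed.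

Lemma normR_eq1 x : normR x = 1 <-> `|x| = 1.
Proof.
by rewrite -scal_normR -(rmorph1 e); split=> [->|/e_inj].
Qed.

Lemma normR_le1 x : (normR x <= 1) = (`|x| <= 1).
Proof. by rewrite -e_le rmorph1 scal_normR. Qed.

Lemma normR_continuous : continuous normR.
Proof.
move=> x; apply: (@continuous_comp X K R Num.norm absK x).
  exact: norm_continuous.
exact: absK_continuous.
Qed.

(** * Rays leaving the unit ball *)

Let ray (u w : X) (r : R) := normR (u + e r *: w).

(** The point at time [s] is the convex combination of [u] and the point at time [r] with weights
    [1 - t] and [t]. Keeping [s = t * r] as a premise lets [t] be a quotient of times. *)
Lemma ray_convex u w (s t r : R) : 0 <= t <= 1 -> s = t * r ->
  normR (u + e s *: w) <= (1 - t) * normR u + t * normR (u + e r *: w).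
Proof.
move=> /andP[t0 t1] ->.
have -> : u + e (t * r) *: w = e (1 - t) *: u + e t *: (u + e r *: w).
  by rewrite scalerDr addrA -scalerDl -rmorphD subrK rmorph1 scale1r scalerA -rmorphM.
apply: le_trans (ler_normRD _ _) _.
by rewrite !normRZ !absK_scal !ger0_norm // subr_ge0.
Qed.

(** Convexity with [t = s / r]: the interior point [u] has positive weight, which makes the bound
    strict. *)
Lemma ray_lt1 u w (s r : R) : normR u < 1 -> normR (u + e r *: w) = 1 ->
  0 <= s < r -> normR (u + e s *: w) < 1.
Proof.
move=> u1 r1 /andP[s0 sr]; have r0 := le_lt_trans s0 sr.
have t1 : s / r < 1 by rewrite ltr_pdivrMr ?mul1r.
have t0 : 0 <= s / r by rewrite divr_ge0 // ltW.
have /= := @ray_convex u w s (s / r) r.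
rewrite t0 (ltW t1) divfK ?gt_eqF // => /(_ isT erefl) /le_lt_trans; apply.
by rewrite r1; nra.
Qed.

(** Now the sphere point lies between [u] and the point at time [s]; if the latter were in the ball,
    convexity would push the sphere point into the interior. *)
Lemma ray_gt1 u w (s r : R) : normR u < 1 -> normR (u + e r *: w) = 1 ->
  0 < r < s -> 1 < normR (u + e s *: w).
Proof.
move=> u1 r1 /andP[r0 rs]; have s0 := lt_trans r0 rs.
have t1 : r / s < 1 by rewrite ltr_pdivrMr ?mul1r.
have t0 : 0 < r / s by rewrite divr_gt0.
have /= := @ray_convex u w r (r / s) s.
rewrite (ltW t0) (ltW t1) divfK ?gt_eqF // => /(_ isT erefl).
by rewrite r1; nra.
Qed.

Lemma cvg_scal {T : Type} {F : set_system T} {FF : Filter F} (r_ : T -> R) r :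
  r_ @ F --> r -> e (r_ t) @[t --> F] --> e r.
Proof. by move=> cr; apply: cvg_comp cr _; exact: scal_continuous. Qed.

Lemma cvg_normR {T : Type} {F : set_system T} {FF : Filter F} (x_ : T -> X) x :
  x_ @ F --> x -> normR (x_ t) @[t --> F] --> normR x.
Proof. by move=> cx; apply: cvg_comp cx _; exact: normR_continuous. Qed.

Lemma cvg_ray {T : Type} {F : set_system T} {FF : Filter F}
    (u_ w_ : T -> X) (r_ : T -> R) u w r :
  u_ @ F --> u -> w_ @ F --> w -> r_ @ F --> r ->
  ray (u_ t) (w_ t) (r_ t) @[t --> F] --> ray u w r.
Proof.
move=> cu cw cr; apply: cvg_normR; apply: cvgD => //.
by apply: cvgZ => //; exact: cvg_scal.
Qed.

(** Intermediate values on [[0, b]]: at time [b = 2 / normR w] the displacement has norm 2, so the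
    triangle inequality puts the ray outside the ball. *)
Lemma ray_meets_sphere u w : normR u < 1 -> w != 0 ->
  exists r, 0 < r /\ normR (u + e r *: w) = 1.
Proof.
move=> u1 w0.
have nw : 0 < normR w by rewrite lt_def normR_eq0 w0 normR_ge0.
set b := 2 / normR w.
have b0 : 0 < b by rewrite divr_gt0.
have gtb : 1 <= normR (u + e b *: w).
  have := ler_normRD (u + e b *: w) (- u).
  rewrite addrAC subrr add0r normRZ absK_scal gtr0_norm // divfK ?gt_eqF //.
  rewrite -scaleN1r normRZ -(rmorph1 e) -rmorphN absK_scal normrN1 mul1r.
  by lra.
have cont : {within `[0, b], continuous (ray u w)}.
  apply: continuous_subspaceT => r.
  by apply: cvg_ray; [exact: cvg_cst|exact: cvg_cst|exact: cvg_id].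
have [|r rb rE] := @IVT R (ray u w) 0 b 1 (ltW b0) cont.
  rewrite /ray rmorph0 scale0r addr0.
  by rewrite ge_min le_max gtb (ltW u1) orbT.
exists r; split => //.
move: rb; rewrite in_itv /= => /andP[r0 _]; rewrite lt_def r0 andbT.
apply/eqP => r00; move: rE; rewrite /ray r00 rmorph0 scale0r addr0 => u1'.
by move: u1; rewrite u1' ltxx.
Qed.

(* Junk ([point]) unless [normR u < 1] and [w != 0]. *)
Definition exit_time u w : R := get [set r | 0 < r /\ normR (u + e r *: w) = 1].

Lemma exit_timeP u w : normR u < 1 -> w != 0 ->
  0 < exit_time u w /\ normR (u + e (exit_time u w) *: w) = 1.
Proof.
move=> u1 w0; have [r rP] := ray_meets_sphere _ _ u1 w0.
exact: (@getI R [set r | 0 < r /\ normR (u + e r *: w) = 1] r rP).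
Qed.

(** Of two distinct crossing times, the earlier would be strictly inside the ball by [ray_lt1]. *)
Lemma exit_time_unique u w r : normR u < 1 -> 0 < r ->
  normR (u + e r *: w) = 1 -> exit_time u w = r.
Proof.
move=> u1 r0 r1.
have w0 : w != 0.
  by apply/eqP => w0; move: u1; rewrite -r1 w0 scaler0 addr0 ltxx.
have [t0 t1] := exit_timeP _ _ u1 w0.
apply/eqP; rewrite eq_le !leNgt; apply/andP; split; apply/negP => lt.
  by have := ray_lt1 _ _ _ _ u1 t1 (introT andP (conj (ltW r0) lt)); rewrite r1 ltxx.
by have := ray_lt1 _ _ _ _ u1 r1 (introT andP (conj (ltW t0) lt)); rewrite t1 ltxx.
Qed.

Lemma exit_timeZ u w (t : R) : normR u < 1 -> w != 0 -> 0 < t ->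
  exit_time u (e t *: w) = exit_time u w / t.
Proof.
move=> u1 w0 t0; have [r0 r1] := exit_timeP _ _ u1 w0.
apply: exit_time_unique => //; first by rewrite divr_gt0.
by rewrite scalerA -rmorphM divfK ?gt_eqF.
Qed.

(** Being strictly inside the ball at time [a] and strictly outside at time [b] are open conditions
    on the pair; together they trap the exit time of nearby rays between [a] and [b]. *)
Lemma exit_time_continuous u w : normR u < 1 -> w != 0 ->
  {for (u, w), continuous (fun z : X * X => exit_time z.1 z.2)}.
Proof.
move=> u1 w0; have [r0 r1] := exit_timeP _ _ u1 w0.
apply/cvgrPdist_lt => eps eps0 /=.
set r := exit_time u w in r0 r1 *.
(* The maximum with [r / 2] keeps [a] positive, since [ray_lt1] and [ray_gt1] compare only points on
   the forward ray. *)
set a := Num.max (r / 2) (r - eps); set b := r + eps.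
have a0 : 0 < a by rewrite lt_max divr_gt0.
have ar : a < r by rewrite gt_max; apply/andP; split; lra.
have aeps : r - eps <= a by rewrite le_max lexx orbT.
have rb : r < b by rewrite /b; lra.
have rayc (s : R) : {for (u, w), continuous (fun z : X * X => ray z.1 z.2 s)}.
  by apply: cvg_ray; [exact: cvg_fst|exact: cvg_snd|exact: cvg_cst].
have lta : ray u w a < 1 by apply: ray_lt1 r1 _ => //; rewrite ltW.
have ltb : 1 < ray u w b by apply: ray_gt1 r1 _ => //; rewrite r0.
have near_u : \forall z \near nbhs (u, w), normR z.1 < 1.
  apply: (cvgr_lt (normR u)) => //.
  by apply: cvg_normR; exact: cvg_fst.
have near_w : \forall z \near nbhs (u, w), normR z.2 > 0.
  apply: (cvgr_gt (normR w)) => //.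
    by apply: cvg_normR; exact: cvg_snd.
  by rewrite lt_def normR_eq0 w0 normR_ge0.
have near_a : \forall z \near nbhs (u, w), ray z.1 z.2 a < 1.
  exact: (cvgr_lt _ (rayc a)).
have near_b : \forall z \near nbhs (u, w), 1 < ray z.1 z.2 b.
  exact: (cvgr_gt _ (rayc b)).
near=> z.
have z1 : normR z.1 < 1 by near: z.
have z2 : z.2 != 0.
  by rewrite -normR_eq0 gt_eqF //; near: z.
have za : ray z.1 z.2 a < 1 by near: z.
have zb : 1 < ray z.1 z.2 b by near: z.
have [t0 t1] := exit_timeP _ _ z1 z2.
have ta : a < exit_time z.1 z.2.
  rewrite ltNge le_eqVlt; apply/negP => /orP[/eqP ta|ta].
    by move: za; rewrite /ray -ta t1 ltxx.
  by have := ray_gt1 _ _ _ _ z1 t1 (introT andP (conj t0 ta)); rewrite ltNge (ltW za).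
have tb : exit_time z.1 z.2 < b.
  rewrite ltNge le_eqVlt; apply/negP => /orP[/eqP tb|tb].
    by move: zb; rewrite /ray tb t1 ltxx.
  have b0 : 0 <= b by rewrite /b; lra.
  by have := ray_lt1 _ _ _ _ z1 t1 (introT andP (conj b0 tb)); rewrite ltNge (ltW zb).
rewrite ltr_distl; apply/andP; split; rewrite /b in tb *; lra.
Unshelve. all: by end_near. Qed.

(** * Moving points of the sphere between level sets of |f| *)

Section Chart.
Variable f : {scalar X}.
Hypothesis f_cont : continuous (f : X -> K).
Variable y : X.
Hypothesis fy : f y = 1.

Let proj (x : X) := x - f x *: y.
Let phase (x : X) : K := f x / `|f x|.

Let f_proj x : f (proj x) = 0.
Proof. by rewrite linearB linearZ /= fy mulr1 subrr. Qed.

(** Otherwise [x = f x *: y], whose norm is less than 1. *)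
Let proj_neq0 x : normR x = 1 -> absK (f x) * normR y < 1 -> proj x != 0.
Proof.
move=> x1 h; apply/eqP => /eqP; rewrite subr_eq0 => /eqP xE.
by move: h; rewrite -normRZ -xE x1 ltxx.
Qed.

Let absK_phase x : f x != 0 -> absK (phase x) = 1.
Proof. by move=> fx0; rewrite absKM absKV absK_norm mulfV ?absK_eq0. Qed.

Let phase_polar x : f x != 0 -> e (absK (f x)) * phase x = f x.
Proof. by move=> fx0; rewrite e_abs mulrC divfK // normr_eq0. Qed.

Let level_center (x : X) (c : R) : X := (e c * phase x) *: y.

Let normR_center x c : f x != 0 -> 0 <= c ->
  normR (level_center x c) = c * normR y.
Proof.
by move=> fx0 c0; rewrite normRZ absKM absK_phase // mulr1 absK_scal ger0_norm.
Qed.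

(** The point where the ray from [level_center x c] in direction [proj x] leaves the ball. The
    direction lies in the kernel of [f], so [f] keeps its value [e c * phase x] along the ray; the
    start is interior when [c * normR y < 1]. *)
Definition level_shift (x : X) (c : R) : X :=
  level_center x c + e (exit_time (level_center x c) (proj x)) *: proj x.

Let f_center x c : f (level_center x c) = e c * phase x.
Proof. by rewrite linearZ /= fy mulr1. Qed.

Lemma f_level_shift x c : f (level_shift x c) = e c * phase x.
Proof. by rewrite linearD f_center linearZ /= f_proj mulr0 addr0. Qed.

Lemma absK_level_shift x c : f x != 0 -> 0 <= c -> absK (f (level_shift x c)) = c.
Proof.
by move=> fx0 c0; rewrite f_level_shift absKM absK_phase // mulr1 absK_scal ger0_norm.
Qed.

Lemma normR_level_shift x c : normR x = 1 -> f x != 0 ->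
    absK (f x) * normR y < 1 -> 0 <= c -> c * normR y < 1 ->
  normR (level_shift x c) = 1.
Proof.
move=> x1 fx0 fxy c0 cy.
have := exit_timeP (level_center x c) (proj x).
by rewrite normR_center // => /(_ cy (proj_neq0 _ x1 fxy)) [].
Qed.

Let phase_level_shift x c : f x != 0 -> 0 < c -> phase (level_shift x c) = phase x.
Proof.
move=> fx0 c0; rewrite {1}/phase f_level_shift normrM -(e_abs (phase x)).
rewrite absK_phase // rmorph1 mulr1 scal_norm gtr0_norm // mulrAC mulfV ?mul1r //.
by rewrite fmorph_eq0 gt_eqF.
Qed.

Let proj_level_shift x c : proj (level_shift x c) =
  e (exit_time (level_center x c) (proj x)) *: proj x.
Proof. by rewrite {1}/proj f_level_shift /level_shift addrAC subrr add0r. Qed.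

(** A shifted point has the phase of [x] and a positive multiple of its projection, so both define
    the same ray for the target level [d]. This yields both inverse laws of the chart. *)
Lemma level_shiftK x c d : normR x = 1 -> f x != 0 ->
    absK (f x) * normR y < 1 -> 0 < c -> c * normR y < 1 ->
    0 <= d -> d * normR y < 1 ->
  level_shift (level_shift x c) d = level_shift x d.
Proof.
move=> x1 fx0 fxy c0 cy d0 dy.
have centerE : level_center (level_shift x c) d = level_center x d.
  by rewrite /level_center phase_level_shift.
have p0 := proj_neq0 _ x1 fxy.
have [|//|r0 _] := exit_timeP (level_center x c) (proj x).
  by rewrite normR_center // ltW.
rewrite /level_shift centerE proj_level_shift exit_timeZ ?normR_center //.
by rewrite scalerA -rmorphM divfK ?gt_eqF.
Qed.

(** The ray for the level of [x] itself starts at [f x *: y] and passes through [x] at time 1. *)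
Lemma level_shift_id x : normR x = 1 -> f x != 0 -> absK (f x) * normR y < 1 ->
  level_shift x (absK (f x)) = x.
Proof.
move=> x1 fx0 fxy; rewrite /level_shift.
have centerE : level_center x (absK (f x)) = f x *: y.
  by rewrite /level_center phase_polar.
rewrite (exit_time_unique _ _ 1) ?normR_center ?absK_ge0 //.
  by rewrite rmorph1 scale1r centerE subrKC.
by rewrite rmorph1 scale1r centerE subrKC.
Qed.

Lemma cvg_level_shift {T : Type} {F : set_system T} {FF : Filter F}
    (x_ : T -> X) (c_ : T -> R) x c :
    normR x = 1 -> f x != 0 -> absK (f x) * normR y < 1 ->
    0 <= c -> c * normR y < 1 ->
    x_ @ F --> x -> c_ @ F --> c ->
  level_shift (x_ t) (c_ t) @[t --> F] --> level_shift x c.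
Proof.
move=> x1 fx0 fxy c0 cy cx cc.
have cf : f (x_ t) @[t --> F] --> f x by apply: cvg_comp cx _; exact: f_cont.
have cp : proj (x_ t) @[t --> F] --> proj x.
  by apply: cvgB => //; apply: cvgZ => //; exact: cvg_cst.
have ccen : level_center (x_ t) (c_ t) @[t --> F] --> level_center x c.
  apply: cvgZ; last exact: cvg_cst.
  apply: cvgM; first exact: cvg_scal.
  apply: cvgM => //; apply: cvgV; first by rewrite normr_eq0.
  exact: cvg_norm.
apply: cvgD => //; apply: cvgZ => //; apply: cvg_scal.
apply: (continuous2_cvg _ _ ccen cp).
by apply: exit_time_continuous; rewrite ?normR_center // proj_neq0.
Qed.

(** * The product chart around a point with |f| = 1 *)

Section Regular.
Variables (c0 : R) (g : [set x : X | `|x| = 1] -> R).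
Hypothesis c0_gt0 : 0 < c0.
Hypothesis gE : forall x, g x = c0 * absK (f (set_val x)).

Let g_continuous : continuous g.
Proof.
have -> : g = fun x => c0 * absK (f (set_val x)) by apply/funext.
move=> x; apply: (@cvgMl_tmp _ _ (nbhs x)).
have cv : set_val t @[t --> x] --> set_val x by exact: initial_continuous.
have cf : f (set_val t) @[t --> x] --> f (set_val x).
  by apply: cvg_comp cv _; exact: f_cont.
by apply: cvg_comp cf _; exact: absK_continuous.
Qed.

(** The chart is the product of the level set |f| = 1 of the sphere with an interval around [c0]: it
    sends [(s, t)] to [level_shift s (t / c0)], and its inverse sends [x] to
    [(level_shift x 1, g x)]. *)
Lemma regular_level (x0 : [set x : X | `|x| = 1]) :
  absK (f (set_val x0)) = 1 -> normR y < 1 -> regular_point g x0.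
Proof.
move=> fx0 ny1.
(* Levels within [d] of 1 are positive, so the phase has modulus 1, and stay below [1 / normR y] in
   the sense that [(1 + d) * normR y < 1], so ray starts are interior. *)
pose d : R := (1 - normR y) / 2.
have ny0 := normR_ge0 y.
have d0 : 0 < d by rewrite /d; lra.
have d1 : d < 1 by rewrite /d; lra.
have dy : (1 + d) * normR y < 1 by rewrite /d; nra.
pose eps : R := c0 * d.
have eps0 : 0 < eps by exact: mulr_gt0.
pose I : set R := `]c0 - eps, c0 + eps[%classic.
pose U : set (set_type [set x : X | `|x| = 1]) := [set x | I (g x)].
pose S : set X := [set x : X | normR x = 1 /\ absK (f x) = 1].
have levelI (c : R) : I (c0 * c) -> 1 - d < c < 1 + d.
  rewrite /I/eps/= in_itv /= => /andP[l u].
  rewrite -(ltr_pM2l c0_gt0) -[X in _ && X](ltr_pM2l c0_gt0).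
  by apply/andP; split; lra.
have level_ok (c : R) : I (c0 * c) -> 0 < c /\ c * normR y < 1.
  by move=> /levelI /andP[l u]; split; nra.
have c0K (s : R) : c0 * (s / c0) = s by rewrite mulrCA mulfV ?mulr1 // gt_eqF.
have in_sphere x : normR x = 1 -> x \in [set x : X | `|x| = 1].
  by move=> /normR_eq1 xE; rewrite inE.
have S_ok x : S x -> [/\ normR x = 1, f x != 0 & absK (f x) * normR y < 1].
  by move=> [x1 fx1]; split => //; rewrite -?absK_eq0 fx1 ?oner_eq0 // mul1r.
have U_ok (x : U) : let z := set_val (set_val x) in
    [/\ normR z = 1, f z != 0, absK (f z) * normR y < 1 & I (c0 * absK (f z))].
  have := set_valP x; rewrite /U /= gE => Iz.
  have [z0 zy] := level_ok _ Iz.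
  split => //; last by rewrite -absK_eq0 gt_eqF.
  by apply/normR_eq1; exact: (set_valP (set_val x)).
have hS (p : S * I) : normR (level_shift (set_val p.1) (set_val p.2 / c0)) = 1.
  have [x1 x2 x3] := S_ok _ (set_valP p.1).
  have [|t0 ty] := level_ok (set_val p.2 / c0); first by rewrite c0K; exact: set_valP.
  by apply: normR_level_shift => //; rewrite ltW.
have hU (p : S * I) : in_set_type (in_sphere _ (hS p)) \in U.
  have [x1 x2 x3] := S_ok _ (set_valP p.1).
  have [|t0 ty] := level_ok (set_val p.2 / c0); first by rewrite c0K; exact: set_valP.
  rewrite inE /U /= gE /= absK_level_shift ?c0K //; last exact: ltW.
  exact: set_valP.
pose h p : U := in_set_type (hU p).
have kS (x : U) : level_shift (set_val (set_val x)) 1 \in S.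
  have [x1 x2 x3 x4] := U_ok x.
  rewrite inE; split; last exact: absK_level_shift.
  by apply: normR_level_shift; rewrite ?mul1r.
have kI (x : U) : c0 * absK (f (set_val (set_val x))) \in I.
  by have [_ _ _ Ix] := U_ok x; rewrite inE.
pose k (x : U) : S * I := (in_set_type (kS x), in_set_type (kI x)).
have fstI (c : R) : c0 * c / c0 = c by rewrite mulrAC mulfV ?mul1r // gt_eqF.
exists U, S, c0, eps, h; split => //.
- apply: (g_continuous x0); apply: open_nbhs_nbhs; split; first exact: itv_open.
  by rewrite /I gE fx0 mulr1 /= in_itv /=; apply/andP; split; lra.
- split.
    apply: (@continuous_in_set_type _ _ U _ hU).
    apply: (@continuous_in_set_type _ _ _ _ (fun p => in_sphere _ (hS p))) => p.
    have [x1 x2 x3] := S_ok _ (set_valP p.1).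
    have [|t0 ty] := level_ok (set_val p.2 / c0); first by rewrite c0K; exact: set_valP.
    apply: (@cvg_level_shift _ (nbhs p)) => //; first exact: ltW.
      apply: (@cvg_comp _ _ _ fst set_val); first exact: cvg_fst.
      exact: initial_continuous.
    apply: (@cvgMr_tmp _ _ (nbhs p)).
    apply: (@cvg_comp _ _ _ snd set_val); first exact: cvg_snd.
    exact: initial_continuous.
  have cval (x : U) : set_val (set_val t) @[t --> x] --> set_val (set_val x).
    apply: (@cvg_comp _ _ _ (set_val : U -> _) set_val).
      exact: initial_continuous.
    exact: initial_continuous.
  have cS : continuous (fun x : U => in_set_type (kS x)).
    apply: (@continuous_in_set_type _ _ S _ kS) => x.
    have [x1 x2 x3 x4] := U_ok x.
    apply: (@cvg_level_shift _ (nbhs x)) => //; first by rewrite mul1r.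
      exact: cval.
    exact: (@cvg_cst R 1 _ (nbhs x)).
  have cI : continuous (fun x : U => in_set_type (kI x)).
    apply: (@continuous_in_set_type _ _ I _ kI) => x.
    apply: (@cvgMl_tmp _ _ (nbhs x)).
    have cf : f (set_val (set_val t)) @[t --> x] --> f (set_val (set_val x)).
      by apply: cvg_comp (cval x) _; exact: f_cont.
    by apply: cvg_comp cf _; exact: absK_continuous.
  exists k; split.
  + by move=> x; exact: (cvg_pair (cS x) (cI x)).
  + move=> [s t]; have [x1 x2 x3] := S_ok _ (set_valP s).
    have [|t0 ty] := level_ok (set_val t / c0); first by rewrite c0K; exact: set_valP.
    congr pair; apply: val_inj => /=.
      rewrite level_shiftK ?mul1r //.
      have [_ /= fs1] := set_valP s.
      (* The target level 1 is the level of [s] itself, as [s] lies in [S]. *)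
      by rewrite -[X in level_shift _ X]fs1 level_shift_id.
    by rewrite absK_level_shift ?c0K // ltW.
  + move=> x; have [x1 x2 x3 x4] := U_ok x.
    have [c1 c2] := level_ok _ x4.
    apply: val_inj; apply: val_inj => /=.
    by rewrite fstI level_shiftK ?mul1r ?level_shift_id // ltW.
- move=> p; have [x1 x2 x3] := S_ok _ (set_valP p.1).
  have [|t0 ty] := level_ok (set_val p.2 / c0); first by rewrite c0K; exact: set_valP.
  by rewrite gE /= absK_level_shift ?c0K // ltW.
Qed.
End Regular.

End Chart.

(** * Bounded coordinates and continuity of linear forms *)

Lemma cvg_big_sum {T I : Type} {F : set_system T} {FF : Filter F} (s : seq I)
    (x_ : I -> T -> X) (x : I -> X) :
  (forall i, x_ i @ F --> x i) ->
  \sum_(i <- s) x_ i t @[t --> F] --> \sum_(i <- s) x i.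
Proof.
move=> cx; elim: s => [|i s IHs].
  rewrite big_nil (_ : (fun _ => _) = fun=> 0); first exact: cvg_cst.
  by apply/funext => t; rewrite big_nil.
rewrite big_cons (_ : (fun _ => _) = (fun t => x_ i t + \sum_(j <- s) x_ j t)).
  exact: cvgD (cx i) IHs.
by apply/funext => t; rewrite big_cons.
Qed.

(** The norm of the combination is continuous and nonzero on the compact unit sphere of R^k, so it
    has a positive minimum there; homogeneity gives the bound with the inverse of this minimum. Real
    coefficients serve both scalar fields. *)
Lemma real_coord_bounded k (w : 'I_k -> X) :
  (forall a : 'rV[R]_k, \sum_j e (a 0 j) *: w j = 0 -> a = 0) ->
  exists2 C, 0 < C & forall a : 'rV[R]_k, `|a| <= C * normR (\sum_j e (a 0 j) *: w j).
Proof.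
move=> w_free; pose comb (a : 'rV[R]_k) := \sum_j e (a 0 j) *: w j.
have combZ (c : R) a : comb (c *: a) = e c *: comb a.
  rewrite /comb scaler_sumr; apply: eq_bigr => j _.
  by rewrite mxE rmorphM scalerA.
pose S : set 'rV[R]_k := [set a | `|a| = 1].
have S_unit (a : 'rV[R]_k) : a != 0 -> S (`|a|^-1 *: a).
  move=> a0; rewrite /S /= normrZ ger0_norm ?invr_ge0 ?normr_ge0 //.
  by rewrite mulVf // normr_eq0.
(* For [k = 0] the sphere is empty and the minimum does not exist, but then every [a] is 0. *)
have [[s Ss]|S0] := pselect (S !=set0); last first.
  exists 1 => // a; have [->|a0] := eqVneq a 0.
    by rewrite normr0 mul1r normR_ge0.
  by exfalso; apply: S0; exists (`|a|^-1 *: a); exact: S_unit.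
have S_compact : compact S.
  apply: bounded_closed_compact.
    by exists 1; split=> // M M1 a /= ->; exact: ltW.
  rewrite (_ : S = Num.norm @^-1` [set 1]) //.
  by apply: closed_comp; [move=> a _; exact: norm_continuous|exact: closed_eq].
have comb_cont : continuous (fun a => normR (comb a)).
  move=> a; apply: (@cvg_normR _ (nbhs a)); apply: cvg_big_sum => j.
  apply: cvgZ; last exact: (@cvg_cst _ _ _ (nbhs a)).
  by apply: (@cvg_scal _ (nbhs a)); exact: coord_continuous.
have [c /set_mem Sc cmin] := @EVT_min_rV R k (fun a => normR (comb a)) S
  (ex_intro _ s Ss) S_compact (continuous_subspaceT comb_cont).
have m0 : 0 < normR (comb c).
  rewrite lt_def normR_ge0 andbT normR_eq0; apply/eqP => /w_free c0.
  by move: Sc; rewrite /S /= c0 normr0 => /esym/eqP; rewrite oner_eq0.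
exists (normR (comb c))^-1; first by rewrite invr_gt0.
move=> a; rewrite mulrC ler_pdivlMr //.
have [->|a0] := eqVneq a 0; first by rewrite normr0 mul0r normR_ge0.
have := cmin _ (mem_set (S_unit _ a0)).
rewrite combZ normRZ absK_scal ger0_norm ?invr_ge0 // mulrC ler_pdivlMr ?normr_gt0 //.
by rewrite mulrC.
Qed.

Lemma bounded_scalar_continuous (f : {scalar X}) (C : R) : 0 < C ->
  (forall x, absK (f x) <= C * normR x) -> continuous (f : X -> K).
Proof.
move=> C0 fC x; apply/(@cvgrPdist_lt _ _ _ (nbhs x)) => eps eps0.
have epsE : e (absK eps) = eps by rewrite e_abs gtr0_norm.
have d0 : 0 < absK eps / C by rewrite divr_gt0 // -e_lt rmorph0 epsE.
have ed0 : 0 < e (absK eps / C) by rewrite -(rmorph0 e) e_lt.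
near=> t; rewrite -linearB /= -e_abs -epsE e_lt.
apply: le_lt_trans (fC _) _; rewrite -ltr_pdivlMl // mulrC -e_lt scal_normR.
by near: t; apply: cvgr_dist_lt => //; exact: cvg_id.
Unshelve. all: by end_near. Qed.

End RealValuedNorm.

(** * Regular points are not maxima; determinants and coordinates *)

Lemma mx_entry_le_norm {R : realDomainType} {m n : nat} (A : 'M[R]_(m, n)) i j :
  `|A i j| <= `|A|.
Proof. by rewrite [leRHS]/Num.norm /= mx_normrE (le_bigmax _ _ (i, j)). Qed.

(** In the product chart the second coordinate is the value of [g], and it can be raised inside its
    open interval with the first coordinate fixed. *)
Lemma regular_point_not_max {R : realType} {M : topologicalType} (g : M -> R)
    (x : M) : regular_point g x -> exists x', g x < g x'.
Proof.
move=> [U [S [a [eps [h [/nbhs_singleton Ux eps0 [_ [h' [_ _ hK]]] gh]]]]]].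
have [[s t] hst] : exists p, h p = in_set_type (mem_set Ux).
  by exists (h' (in_set_type (mem_set Ux))).
have := gh (s, t); rewrite hst /= => ->.
have /andP[lt tu] : a - eps < set_val t < a + eps.
  by have := set_valP t; rewrite /= in_itv.
pose t' := (set_val t + (a + eps)) / 2.
have t'I : t' \in `]a - eps, a + eps[%classic.
  by rewrite inE /= in_itv /= /t'; apply/andP; split; lra.
exists (set_val (h (s, in_set_type t'I))); rewrite gh.
by rewrite -[X in _ < X]/t' /t'; lra.
Qed.

(** Both sides are linear in [x], so it suffices to compare them on the basis: [x = W_i] gives the
    full determinant, and any other basis vector repeats a row. *)
Lemma det_replace_row {K : fieldType} {X : vectType K} n
    (phi : {linear X -> 'rV[K]_n}) (W : n.-tuple X) (i : 'I_n) (x : X) :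
  basis_of fullv W ->
  \det (\matrix_(j < n) phi (if j == i then x else tnth W j)) =
  coord W i x * \det (\matrix_(j < n) phi (tnth W j)).
Proof.
move=> bW; pose M z := \matrix_(j < n) phi (if j == i then z else tnth W j).
have L : scalar (fun z => \det (M z)).
  move=> a u v.
  rewrite (@determinant_multilinear _ _ _ (M u) (M v) i a 1) ?mul1r //.
  - by rewrite !rowK eqxx linearP scale1r.
  - by apply/matrixP => j k; rewrite !mxE eq_sym (negbTE (neq_lift _ _)).
  - by apply/matrixP => j k; rewrite !mxE eq_sym (negbTE (neq_lift _ _)).
pose F : {scalar X} := HB.pack (fun z => \det (M z)) (GRing.isLinear.Build _ _ _ _ _ L).
have FE z : F z = \det (M z) by [].
have Fi : F W`_i = \det (\matrix_(j < n) phi (tnth W j)).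
  rewrite FE; congr (\det _); apply/row_matrixP => j; rewrite !rowK -tnth_nth.
  by case: eqP => // ->.
have Fj j : j != i -> F W`_j = 0.
  move=> ji; rewrite FE (determinant_alternate ji) // => k.
  by rewrite !mxE (negbTE ji) eqxx -tnth_nth.
rewrite -/(M x) -FE {1}(coord_basis bW (memvf x)) linear_sum (bigD1 i) //.
rewrite linearZ Fi big1 => [|j ji]; first by rewrite /= addr0.
by rewrite linearZ Fj //= mulr0.
Qed.

(** A linear relation between the rows pulls back through the injective [phi] to a relation between
    the vectors of [W]. *)
Lemma det_basis_neq0 {K : fieldType} {X : vectType K} n
    (phi : {linear X -> 'rV[K]_n}) (W : n.-tuple X) :
  injective phi -> basis_of fullv W ->
  \det (\matrix_(j < n) phi (tnth W j)) != 0.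
Proof.
move=> phi_inj bW; rewrite -unitfE -unitmxE -row_free_unit; apply: inj_row_free => v.
rewrite mulmx_sum_row (eq_bigr (fun j => phi (v 0 j *: tnth W j))); last first.
  by move=> j _; rewrite rowK linearZ.
rewrite -linear_sum => /eqP; rewrite raddf_eq0 // => /eqP sum0.
apply/rowP => j; rewrite mxE.
move: (basis_free bW) => /freeP/(_ (v 0)); apply.
by rewrite -[RHS]sum0; apply: eq_bigr => k _; rewrite -tnth_nth.
Qed.

(** * Both implications, given bounded coordinate forms *)

Section AuerbachBifurcation.
Context {R : realType} {K : numFieldType}.
Variables (e : {rmorphism R -> K}) (absK : K -> R).
Hypothesis e_le : {mono e : a b / a <= b}.
Hypothesis e_abs : forall z, e (absK z) = `|z|.
Context {X : finBanachType K} {n : nat}.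
Variables (phi : {linear X -> 'rV[K]_n}) (W : n.-tuple X).
Hypothesis normW : forall i, tnth W i \in unit_sphere X.
Hypothesis phi_inj : injective phi.
Hypothesis bW : basis_of fullv W.
Hypothesis coord_bounded : forall i, exists2 C : R, 0 < C &
  forall x, absK (coord W i x) <= C * normR absK x.

Let D := absK (\det (\matrix_(j < n) phi (tnth W j))).

Let absK1 : absK 1 = 1.
Proof. by rewrite -(rmorph1 e) (absK_scal e absK e_le e_abs) normr1. Qed.

Let D_gt0 : 0 < D.
Proof.
rewrite lt_def (absK_ge0 e absK e_le e_abs) andbT (absK_eq0 e absK e_abs).
exact: det_basis_neq0.
Qed.

Let absdetE i x : absdet absK phi W i x = D * absK (coord W i (set_val x)).
Proof.
by rewrite /absdet det_replace_row // (absKM e absK e_abs) mulrC.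
Qed.

Let coordW i j : coord W i (tnth W j) = (i == j)%:R.
Proof. by rewrite (tnth_nth 0) coord_free ?(basis_free bW) // eq_sym. Qed.

Let coord_cont i : continuous (coord W i : X -> K).
Proof.
have [C C0 fC] := coord_bounded i.
exact: (bounded_scalar_continuous e absK e_le e_abs _ C).
Qed.

Let dual_coord (f : 'Hom(X, K^o)) i :
  (forall j, f (tnth W j) = (i == j)%:R) -> forall x, f x = coord W i x.
Proof.
move=> fW x; rewrite {1}(coord_basis bW (memvf x)) linear_sum (bigD1 i) //=.
rewrite linearZ /= -tnth_nth fW eqxx scaler1 big1 ?addr0 // => j ji.
by rewrite linearZ /= -tnth_nth fW eq_sym (negbTE ji) scaler0.
Qed.

(* An unbounded set has [sup] 0, so [dual_norm f = 1] does imply that [f] is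
   bounded. *)
Lemma dual_norm_le1 (f : 'Hom(X, K^o)) x :
  dual_norm absK f = 1 -> `|x| <= 1 -> absK (f x) <= 1.
Proof.
move=> f1 x1; rewrite -f1; apply: ub_le_sup; last by exists x.
have [[_]//|/sup_out] :=
  pselect (has_sup [set absK (f x) | x in [set x : X | `|x| <= 1]]).
by move: f1; rewrite /dual_norm => -> /eqP; rewrite oner_eq0.
Qed.

(** The [i]-th dual vector is the coordinate form; having norm 1, it makes the [i]-th vector a
    global maximum of [absdet] on the sphere. *)
Lemma auerbach_bifurcation :
  auerbach_basis absK W -> forall i,
  bifurcation_point (absdet absK phi W i) (exist _ (tnth W i) (normW i)).
Proof.
move=> [_ _ [W' [_ W'W W'1]]] i /regular_point_not_max[x].
rewrite !absdetE /= coordW eqxx absK1 (ltr_pM2l D_gt0) ltNge => /negP; apply.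
rewrite -(dual_coord _ _ (W'W i)); apply: dual_norm_le1 => //.
by have -> : `|set_val x| = 1 by exact: (set_valP x).
Qed.

Lemma bifurcation_coord_le1 i x :
  bifurcation_point (absdet absK phi W i) (exist _ (tnth W i) (normW i)) ->
  `|x| <= 1 -> absK (coord W i x) <= 1.
Proof.
move=> bif x1; rewrite leNgt; apply/negP => fx.
have fx_gt0 : 0 < absK (coord W i x) := lt_trans ltr01 fx.
have fx0 : coord W i x != 0 by rewrite -(absK_eq0 e absK e_abs) gt_eqF.
apply: bif.
(* If the form exceeds 1 in modulus at [x], then [x] divided by its coordinate has coordinate 1 and
   norm less than 1, as the chart requires of [y]. *)
apply: (regular_level e absK e_le e_abs (coord W i) (coord_cont i)
  ((coord W i x)^-1 *: x) _ D _ D_gt0 (absdetE i)).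
- by rewrite linearZ /= mulVf.
- by rewrite /= coordW eqxx absK1.
- rewrite (normRZ e absK e_abs) (absKV e absK e_abs) mulrC ltr_pdivrMr // mul1r.
  by apply: le_lt_trans fx; rewrite (normR_le1 e absK e_le e_abs).
Qed.

(** The coordinate forms serve as dual basis: they are bounded by 1 on the ball, and the [i]-th one
    reaches 1 at the [i]-th vector. *)
Lemma bifurcation_auerbach :
  (forall i, bifurcation_point (absdet absK phi W i) (exist _ (tnth W i) (normW i))) ->
  auerbach_basis absK W.
Proof.
move=> bif; split => // [i|]; first by have := normW i; rewrite inE.
have [W' W'E] : exists W' : n.-tuple 'Hom(X, K^o),
    forall i x, tnth W' i x = coord W i x.
  exists [tuple linfun (coord W i : X -> K^o) | i < n] => i x.
  by rewrite tnth_mktuple lfunE.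
have W'W i j : tnth W' i (tnth W j) = (i == j)%:R by rewrite W'E coordW.
exists W'; split => // [|i].
  rewrite basisEfree; apply/and3P; split.
  - apply/freeP => k k0 i; move/lfunP/(_ (tnth W i)): k0.
    rewrite sum_lfunE (bigD1 i) //= big1 ?addr0.
      by rewrite -tnth_nth scale_lfunE W'W eqxx scaler1 lfunE.
    by move=> j ji; rewrite -tnth_nth scale_lfunE W'W (negbTE ji) scaler0.
  - exact: subvf.
  (* Biorthogonality gave independence; spanning follows by counting, the dual having dimension
     [n * 1]. *)
  - rewrite size_tuple -[X in (_ <= X)%N](size_basis bW) !dimvf /dim /=.
    by rewrite muln1.
have i1 : `|tnth W i| <= 1 by have := normW i; rewrite inE => ->.
apply/eqP; rewrite eq_le; apply/andP; split.
  apply: ge_sup; first by exists (absK (tnth W' i (tnth W i))); exists (tnth W i).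
  by move=> _ [x x1 <-]; rewrite W'E; exact: bifurcation_coord_le1.
apply: ub_le_sup; last by exists (tnth W i) => //; rewrite W'W eqxx absK1.
by exists 1 => _ [x x1 <-]; rewrite W'E; exact: bifurcation_coord_le1.
Qed.

End AuerbachBifurcation.

(** * Boundedness of the coordinate forms over R and over C *)

Lemma real_coord_le_norm {R : realType} {X : finBanachType R} n
    (W : n.-tuple X) (i : 'I_n) : basis_of fullv W ->
  exists2 C : R, 0 < C & forall x, `|coord W i x| <= C * normR Num.norm x.
Proof.
move=> bW; pose e : {rmorphism R -> R} := idfun.
have e_le : {mono e : a b / a <= b} by [].
have e_abs (z : R) : e `|z| = `|z| by [].
have [|C C0 hC] := @real_coord_bounded R R e Num.norm e_le e_abs X n (tnth W).
  move=> a a0; apply/rowP => j; rewrite mxE.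
  move: (basis_free bW) => /freeP/(_ (a 0)); apply.
  by rewrite -[RHS]a0; apply: eq_bigr => k _; rewrite -tnth_nth.
exists C => // x.
pose a : 'rV[R]_n := \row_j coord W j x.
have := hC a; rewrite (_ : \sum_j _ = x).
  by apply: le_trans; have := mx_entry_le_norm a 0 i; rewrite mxE.
rewrite [RHS](coord_basis bW (memvf x)).
by apply: eq_bigr => k _; rewrite mxE -tnth_nth.
Qed.

(** The vectors of [W] together with their multiples by ['i] are independent over the reals, and
    their real coefficients are the real and imaginary parts of the complex coordinates. *)
Lemma complex_coord_le_norm {R : realType} {X : finBanachType R[i]} n
    (W : n.-tuple X) (i : 'I_n) (absC := fun z : R[i] => complex.Re `|z|) :
  basis_of fullv W ->
  exists2 C : R, 0 < C & forall x, absC (coord W i x) <= C * normR absC x.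
Proof.
move=> bW; pose e : {rmorphism R -> R[i]} := real_complex R.
have e_le : {mono e : a b / a <= b} by move=> a b; exact: lecR.
have e_abs (z : R[i]) : e (absC z) = `|z| by exact: RRe_real (normr_real _).
pose w (l : 'I_(n + n)) : X := match fintype.split l with
  | inl j => tnth W j | inr j => 'i%C *: tnth W j end.
have wE (a : 'rV[R]_(n + n)) : \sum_l e (a 0 l) *: w l =
    \sum_(j < n) (a 0 (lshift n j) +i* a 0 (rshift n j))%C *: tnth W j.
  rewrite big_split_ord /= -big_split /=; apply: eq_bigr => j _.
  rewrite /w (unsplitK (inl j)) (unsplitK (inr j)) scalerA -scalerDl.
  by congr (_ *: _); rewrite [RHS]complexE /= [e _ * _]mulrC.
have [|M M0 hM] := @real_coord_bounded R R[i] e absC e_le e_abs X _ w.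
  move=> a; rewrite wE => a0.
  have z0 j : (a 0 (lshift n j) +i* a 0 (rshift n j))%C = 0 :> R[i].
    move: (basis_free bW).
    move=> /freeP/(_ (fun j => a 0 (lshift n j) +i* a 0 (rshift n j))%C).
    by apply; rewrite -[RHS]a0; apply: eq_bigr => k _; rewrite -tnth_nth.
  apply/rowP => l; rewrite mxE -(splitK l).
  by case: (fintype.split l) => j /=; case: (z0 j).
(* The modulus of a coordinate is at most the sum of the moduli of its two parts, each at most [M]
   times the norm. *)
exists (2 * M) => [|x]; first by rewrite mulr_gt0.
pose a : 'rV[R]_(n + n) :=
  row_mx (\row_j complex.Re (coord W j x)) (\row_j complex.Im (coord W j x)).
have := hM a; rewrite wE (_ : \sum_j _ = x); last first.
  rewrite [RHS](coord_basis bW (memvf x)); apply: eq_bigr => k _.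
  rewrite row_mxEl row_mxEr !mxE -tnth_nth; congr (_ *: _).
  by case: (coord W k x).
move=> aM.
have zE : coord W i x = e (a 0 (lshift n i)) + 'i%C * e (a 0 (rshift n i)).
  by rewrite row_mxEl row_mxEr !mxE -complexE.
have : absC (coord W i x) <= `|a 0 (lshift n i)| + `|a 0 (rshift n i)|.
  rewrite -e_le e_abs {1}zE rmorphD -!(scal_norm e e_le).
  apply: le_trans (ler_normD _ _) _; rewrite normrM (_ : `|'i%C| = 1) ?mul1r //.
  by rewrite normc_def /= expr0n /= add0r expr1n sqrtr1.
move/le_trans; apply; rewrite -mulrA mulr_natl mulr2n.
by apply: lerD; apply: le_trans (mx_entry_le_norm _ _ _) aM.
Qed.

Theorem theorem6p3 (R : realType) :
  (forall (n : nat) (X : finBanachType R) (phi : {linear X -> 'rV[R]_n})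
      (W : n.-tuple X) (normW : forall i, tnth W i \in unit_sphere X),
    \dim {:X} = n -> bijective phi -> basis_of fullv W ->
    auerbach_basis (fun a : R => `|a|) W <->
    forall i, bifurcation_point (absdet (fun a : R => `|a|) phi W i)
                (exist _ (tnth W i) (normW i)))
  /\
  (forall (n : nat) (X : finBanachType R[i]) (phi : {linear X -> 'rV[R[i]]_n})
      (W : n.-tuple X) (normW : forall i, tnth W i \in unit_sphere X),
    \dim {:X} = n -> bijective phi -> basis_of fullv W ->
    auerbach_basis (fun z : R[i] => complex.Re `|z|) W <->
    forall i, bifurcation_point
                (absdet (fun z : R[i] => complex.Re `|z|) phi W i)
                (exist _ (tnth W i) (normW i))).
Proof.
split=> n X phi W normW _ /bij_inj phi_inj bW.
- have e_le : {mono (idfun : {rmorphism R -> R}) : a b / a <= b} by [].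
  have e_abs (z : R) : (idfun : {rmorphism R -> R}) `|z| = `|z| by [].
  split; first exact: (auerbach_bifurcation _ _ e_le e_abs).
  apply: (bifurcation_auerbach _ _ e_le e_abs) => // i.
  exact: real_coord_le_norm.
- have e_le : {mono (real_complex R : {rmorphism R -> R[i]}) : a b / a <= b}.
    by move=> a b; exact: lecR.
  have e_abs (z : R[i]) :
      (real_complex R : {rmorphism R -> R[i]}) (complex.Re `|z|) = `|z|.
    by exact: RRe_real (normr_real _).
  split; first exact: (auerbach_bifurcation _ _ e_le e_abs).
  apply: (bifurcation_auerbach _ _ e_le e_abs) => // i.
  exact: complex_coord_le_norm.
Qed.
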